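(* Let $R\in\bar S$. (a) $$(N;G)\underline{\int}_{R} g(I)\;\le\;(F)\underline{\int}_{R} g(I)\;\le\;(F)\overline{\int}_{R} g(I)\;\le\;(N;G)\overline{\int}_{R} g(I).$$ (b) If $F$ also satisfies axiom (iv), then $$(N;G)\underline{\int}_{R} g(I)=(F)\underline{\int}_{R} g(I),\qquad (N;G)\overline{\int}_{R} g(I)=(F)\overline{\int}_{R} g(I).$$
   Context: Fix real $A<B$ and $W=[A,B]$. An interval is any of $(a,b),[a,b),(a,b],[a,b]$ with $A\le a<b\le B$; its length is $mI=b-a$. Two intervals overlap if they have a non-degenerate interval in common. An $I^\sigma$ is a finite union of intervals. $E'$ denotes the derived set (set of limit points) of $E$. $S$ is a fixed non-empty set of intervals and $g:S\to\mathbb R$ is a function. $\bar S$ is the collection of all $I^\sigma$ which are finite unions of points of $W$ and interiors of intervals of $S$. A division $D$ of an $I^\sigma$ $R$ is a finite set of pairwise non-overlapping intervals of $S$ (each with its own end-point brackets), the union of whose closures is $R'$; norm$(D)$ is the greatest length of its intervals, and $(R;D)\sum g(I)$ is the sum of $g(I)$ over the intervals $I$ of $D$. A Riemann succession of divisions of $R$ is a sequence $\{D_n\}$ of divisions of $R$ with norm$(D_n)\to0$. For divisions $D^{(1)},D^{(2)}$ of non-overlapping sets $R_1,R_2$, $D^{(1)}+D^{(2)}$ is the division of $R_1\cup R_2$ formed by all their intervals. $F$ is a family of Riemann successions of divisions of sets $R\in\bar S$ satisfying: (i) for every $R\in\bar S$ there is at least one Riemann succession of divisions of $R$ in $F$;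 (ii) if $\{D_n\}\in F$ and $n_i$ is a sequence of integers tending to infinity, then $\{D_{n_i}\}\in F$; (iii) if $R_1,R_2\in\bar S$ are non-overlapping and $\{D_{1,n}\},\{D_{2,n}\}\in F$ are over $R_1,R_2$ respectively, then $\{D_{1,n}+D_{2,n}\}\in F$. Axiom (iv): if $\{D^{(i)}_n\}_n$ ($i=1,2,\dots$) are Riemann successions in $F$ of divisions of the same $R\in\bar S$, and if the sequence $D^{(1)}_1,D^{(1)}_2,D^{(2)}_1,D^{(1)}_3,D^{(2)}_2,D^{(3)}_1,D^{(1)}_4,\dots$ is a Riemann succession, then it is in $F$. $G$ is the set of all divisions occurring in the Riemann successions of $F$. Integrals (values in $[-\infty,+\infty]$). The upper Burkill integral $(F)\overline{\int}_R g(I)$ is the supremum of $\overline{\lim}_{n\to\infty}(R;D_n)\sum g(I)$ over all $\{D_n\}\in F$ of divisions of $R$; the lower Burkill integral $(F)\underline{\int}_R g(I)$ is the infimum of $\underline{\lim}_{n\to\infty}(R;D_n)\sum g(I)$. The upper norm-limit $(N;G)\overline{\int}_R g(I)$ is $\inf_{e>0}d(e)$, where $d(e)$ is the supremum of $(R;D)\sum g(I)$ over all divisions $D\in G$ of $R$ with norm$(D)<e$; the lower norm-limit $(N;G)\underline{\int}_R g(I)$ is defined similarly with $\sup_{e>0}$ of infima. *)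

(* Defs.v *)
From HB Require Import structures.
From mathcomp Require Import all_boot all_order all_algebra.
From mathcomp Require Import finmap.
From mathcomp Require Import all_classical all_reals all_analysis.

Set Implicit Arguments.
Unset Strict Implicit.
Unset Printing Implicit Defensive.

Import Order.TTheory GRing.Theory Num.Theory.
Import numFieldNormedType.Exports.

Local Open Scope classical_set_scope.
Local Open Scope ring_scope.

(* The booleans [l] and [r] choose the end-point brackets, so that all four of
   (a,b), [a,b), (a,b], [a,b] occur.  Since a < b, distinct terms denote
   distinct point sets. *)
Definition itvs (R : realType) (A B : R) : set (interval R) :=
  [set I | exists (a b : R) (l r : bool),
     [/\ A <= a, a < b, b <= B & I = Interval (BSide l a) (BSide r b)]].

(* The infinite intervals (value 0) are never elements of [itvs A B]. *)
Definition itv_length (R : realType) (I : interval R) : R :=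
  if I is Interval (BSide _ a) (BSide _ b) then b - a else 0.

Definition overlap (R : realType) (A B : R) (X Y : set R) : Prop :=
  exists2 J, itvs A B J & [set` J] `<=` X `&` Y.

Definition is_Isigma (R : realType) (A B : R) (X : set R) : Prop :=
  exists2 T : {fset (interval R)}, [set` T] `<=` itvs A B &
    X = \bigcup_(I in [set` T]) [set` I].

Definition Sbar (R : realType) (A B : R) (S : set (interval R)) :
    set (set R) :=
  [set X | is_Isigma A B X /\
     exists (P : {fset R}) (T : {fset (interval R)}),
       [/\ [set` P] `<=` `[A, B], [set` T] `<=` S &
           X = [set` P] `|` \bigcup_(I in [set` T]) interior [set` I]]].

Definition division (R : realType) (A B : R) (S : set (interval R))
    (X : set R) (D : {fset (interval R)}) : Prop :=
  [/\ [set` D] `<=` S,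
      forall I J, I \in D -> J \in D -> I != J ->
        ~ overlap A B [set` I] [set` J] &
      \bigcup_(I in [set` D]) closure [set` I] = limit_point X].

(* The norm of the empty division (which divides only the empty set) is 0. *)
Definition div_norm (R : realType) (D : {fset (interval R)}) : R :=
  \big[Num.max/0]_(I <- enum_fset D) itv_length I.

Definition div_sum (R : realType) (g : interval R -> R)
    (D : {fset (interval R)}) : R :=
  \sum_(I <- enum_fset D) g I.

(* Sequences are indexed from 0. *)
Definition riemann_succession (R : realType) (A B : R)
    (S : set (interval R)) (X : set R)
    (D : nat -> {fset (interval R)}) : Prop :=
  (forall n, division A B S X (D n)) /\
  (fun n => div_norm (D n)) @ \oo --> (0 : R).

Record succession_family (R : realType) (A B : R) (S : set (interval R))
    (F : set (nat -> {fset (interval R)})) : Prop := {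
  sf_succession : forall D, F D ->
    exists2 X, Sbar A B S X & riemann_succession A B S X D;
  sf_exists : forall X, Sbar A B S X ->
    exists2 D, F D & riemann_succession A B S X D;
  (* [k] tends to infinity but need not be increasing. *)
  sf_subseq : forall (D : nat -> {fset (interval R)}) (k : nat -> nat),
    F D -> k @ \oo --> \oo -> F (fun i => D (k i));
  sf_add : forall (X1 X2 : set R) (D1 D2 : nat -> {fset (interval R)}),
    Sbar A B S X1 -> Sbar A B S X2 -> ~ overlap A B X1 X2 ->
    F D1 -> F D2 ->
    riemann_succession A B S X1 D1 -> riemann_succession A B S X2 D2 ->
    F (fun n => (D1 n `|` D2 n)%fset)
}.

(* The enumeration (0,0), (0,1), (1,0), (0,2), (1,1), (2,0), (0,3), ... of
   the pairs (i, n), where (i, n) stands for the n-th term of the i-th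
   succession. *)
Definition diag_next (p : nat * nat) : nat * nat :=
  if p.2 is n.+1 then (p.1.+1, n) else (0%N, p.1.+1).

Definition diag_index (m : nat) : nat * nat :=
  iter m diag_next (0%N, 0%N).

Definition diagonal_axiom (R : realType) (A B : R) (S : set (interval R))
    (F : set (nat -> {fset (interval R)})) : Prop :=
  forall (X : set R) (D : nat -> nat -> {fset (interval R)}),
    Sbar A B S X ->
    (forall i, F (D i) /\ riemann_succession A B S X (D i)) ->
    let E := fun m => D (diag_index m).1 (diag_index m).2 in
    riemann_succession A B S X E -> F E.

Definition family_divisions (R : realType)
    (F : set (nat -> {fset (interval R)})) : set {fset (interval R)} :=
  [set D | exists2 s, F s & exists n, D = s n].

Definition upper_burkill (R : realType) (A B : R) (S : set (interval R))
    (g : interval R -> R) (F : set (nat -> {fset (interval R)}))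
    (X : set R) : \bar R :=
  ereal_sup [set limn_esup (fun n => (div_sum g (D n))%:E)
            | D in F `&` riemann_succession A B S X].

Definition lower_burkill (R : realType) (A B : R) (S : set (interval R))
    (g : interval R -> R) (F : set (nat -> {fset (interval R)}))
    (X : set R) : \bar R :=
  ereal_inf [set limn_einf (fun n => (div_sum g (D n))%:E)
            | D in F `&` riemann_succession A B S X].

Definition sums_below (R : realType) (A B : R) (S : set (interval R))
    (g : interval R -> R) (G : set {fset (interval R)})
    (X : set R) (e : R) : set (\bar R) :=
  [set (div_sum g D)%:E
  | D in [set D | [/\ G D, division A B S X D & div_norm D < e]]].

Definition upper_norm_limit (R : realType) (A B : R) (S : set (interval R))
    (g : interval R -> R) (G : set {fset (interval R)})
    (X : set R) : \bar R :=
  ereal_inf [set ereal_sup (sums_below A B S g G X e)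
            | e in [set e : R | 0 < e]].

Definition lower_norm_limit (R : realType) (A B : R) (S : set (interval R))
    (g : interval R -> R) (G : set {fset (interval R)})
    (X : set R) : \bar R :=
  ereal_sup [set ereal_inf (sums_below A B S g G X e)
            | e in [set e : R | 0 < e]].

(* Main.v *)
Require Import Defs.
From HB Require Import structures.
From mathcomp Require Import all_boot all_order all_algebra.
From mathcomp Require Import finmap.
From mathcomp Require Import all_classical all_reals all_analysis.

Set Implicit Arguments.
Unset Strict Implicit.
Unset Printing Implicit Defensive.

Import Order.TTheory GRing.Theory Num.Theory.
Import numFieldNormedType.Exports.

Local Open Scope classical_set_scope.
Local Open Scope ring_scope.

(** Upper and lower integrals are exchanged, up to sign, by replacing [g] with
    [- g], so only the upper ones need work.  The lower Burkill integral is at most the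
    upper one because [F] contains at least one succession over [X], whose
    lower limit of sums is at most its upper limit.

    A Riemann succession over [X] has norms tending to 0, so its sums are
    eventually among the sums over divisions of norm less than [e], for every
    positive [e]; hence every upper limit of sums is at most the upper
    norm-limit ([upper_burkill_le_norm_limit]).

    For the converse, let [r] be real and below the upper norm-limit.  For
    each [i] there is a division [D_i] of [X] in [G], of norm less than
    1/(i+1), with a sum exceeding [r].  It is a term of some succession of
    [F]; passing to a subsequence, it becomes the initial term of a
    succession in [F] whose [n]-th norm is less than 1/(i+n+1)
    ([row_through_division]).  Take this as the [i]-th row of an infinite
    array.  The diagonal enumeration of the array visits pairs (i, n) with
    [i + n] tending to infinity, so the norms along it tend to 0 and the
    diagonal axiom puts it in [F].  It also visits every (i, 0), where the sum
    exceeds [r], so the upper limit of its sums is at least [r]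
    ([upper_norm_limit_le_burkill]). *)

Lemma lee_of_fin_below (R : realType) (x y : \bar R) :
  (forall r : R, (r%:E < x)%E -> (r%:E <= y)%E) -> (x <= y)%E.
Proof.
case: x => [r||] xy; last by rewrite leNye.
- apply/lee_subgt0Pr => e e0.
  by rewrite -EFinB; apply: xy; rewrite lte_fin ltrBlDr ltrDl.
- by rewrite leye_eq; apply/eqP/eqyP => a _; apply: xy; rewrite ltry.
Qed.

Lemma le_limn_esup_frequently (R : realType) (u : nat -> \bar R) (x : \bar R) :
  (forall n, exists2 m, (n <= m)%N & (x <= u m)%E) -> (x <= limn_esup u)%E.
Proof.
move=> xu; apply/ereal_infP => _ [V [n _ nV] <-].
have [m nm xum] := xu n.
by apply: le_ereal_sup_tmp; exists (u m) => //; exists m => //; apply: nV.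
Qed.

Lemma limn_esup_le_near (R : realType) (u : nat -> \bar R) (x : \bar R) :
  (\forall n \near \oo, (u n <= x)%E) -> (limn_esup u <= x)%E.
Proof.
move=> ux; apply: ge_ereal_inf; exists (ereal_sup (u @` [set n | (u n <= x)%E])).
  by exists [set n | (u n <= x)%E].
by apply: ge_ereal_sup => _ [n /= uxn <-].
Qed.

(** The index [n0] is placed first, possibly out of order; the later indices
    are chosen at least [n], to force divergence, and far enough out for
    [a] to be below [e n]. *)
Lemma cvg0_subseq_lt (R : realType) (a e : nat -> R) (n0 : nat) :
  a @ \oo --> (0 : R) -> (forall n, 0 < e n) -> a n0 < e 0%N ->
  exists k : nat -> nat,
    [/\ k @ \oo --> \oo, k 0%N = n0 & forall n, a (k n) < e n].
Proof.
move=> a0 e0 an0.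
have {}a0 n : exists N : nat, (n <= N)%N /\ a N < e n.
  have /cvgr0_norm_lt/(_ (e n) (e0 n)) [N _ HN] := a0.
  exists (maxn n N); split; first exact: leq_maxl.
  by apply: le_lt_trans (ler_norm _) (HN _ _); rewrite /= leq_maxr.
have [k kP] := choice a0.
exists (fun n => if n is m.+1 then k m.+1 else n0); split=> //; last first.
  by case=> [//|n]; have [] := kP n.+1.
apply/cvgnyPge => N; exists N.+1 => // -[//|n] /= Nn.
by have [+ _] := kP n.+1; apply: leq_trans; apply: ltnW.
Qed.

Lemma iter_diag_next (j i n : nat) : (j <= n)%N ->
  iter j diag_next (i, n) = ((i + j)%N, (n - j)%N).
Proof.
elim: j => [|j IH] jn; first by rewrite addn0 subn0.
by rewrite iterS IH ?(ltnW jn)// /diag_next/= subnS -subSS subSn// addnS.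
Qed.

(** The diagonal of sum [s] ends at (s, 0), and the next one, entered at
    (0, s+1), ends [s + 1] steps later at (s+1, 0). *)
Lemma diag_index_start (s : nat) :
  exists2 m, (s <= m)%N & diag_index m = (s, 0%N).
Proof.
elim: s => [|s [m sm ms]]; first by exists 0%N.
exists (s.+1 + m.+1)%N; first exact: leq_addr.
have m1s : diag_index m.+1 = (0%N, s.+1).
  by rewrite /diag_index iterS -/(diag_index m) ms.
by rewrite /diag_index iterD -/(diag_index m.+1) m1s iter_diag_next// subnn.
Qed.

Lemma diag_index_sum_homo (m n : nat) : (m <= n)%N ->
  ((diag_index m).1 + (diag_index m).2 <=
   (diag_index n).1 + (diag_index n).2)%N.
Proof.
move=> /subnK; move: (n - m)%N => k <-; elim: k => [//|k IH]; apply: leq_trans IH _.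
rewrite /diag_index addSn iterS; case: (iter _ _ _) => i [|j] /=.
  by rewrite addn0.
by rewrite addnS.
Qed.

Lemma diag_index_sum_cvg :
  (fun m => ((diag_index m).1 + (diag_index m).2)%N) @ \oo --> \oo.
Proof.
apply/cvgnyPge => s; have [m _ ms] := diag_index_start s.
by exists m => // n /= /diag_index_sum_homo; rewrite ms addn0.
Qed.

Lemma div_norm_ge0 (R : realType) (D : {fset (interval R)}) : 0 <= div_norm D.
Proof. exact: bigmax_ge_id. Qed.

(** A succession of [F] is given over some set [Y], possibly other than [X].
    A division determines only the derived set of what it divides: one common
    division forces [Y] and [X] to have the same derived set, and then all
    divisions of [Y] are divisions of [X]. *)
Lemma succession_of_division (R : realType) (A B : R) (S : set (interval R))
    (F : set (nat -> {fset (interval R)})) (X : set R) s n :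
  succession_family A B S F -> F s -> division A B S X (s n) ->
  riemann_succession A B S X s.
Proof.
move=> hF Fs [_ _ sX]; have [Y _ [sY s0]] := sf_succession hF Fs.
split=> // m; have [_ _ nY] := sY n; have [mS mo mY] := sY m.
by split=> //; rewrite mY -nY.
Qed.

Section norm_limit.
Context (R : realType) (A B : R) (S : set (interval R)) (g : interval R -> R).
Context (F : set (nat -> {fset (interval R)})) (X : set R).
Hypotheses (hF : succession_family A B S F).
Let G := family_divisions F.

Lemma upper_burkill_le_norm_limit :
  (upper_burkill A B S g F X <= upper_norm_limit A B S g G X)%E.
Proof.
apply/ereal_infP => _ [e /= e0 <-]; apply: ge_ereal_sup => _ [s [Fs [sX s0]] <-].
apply: limn_esup_le_near.
have /cvgr0_norm_lt/(_ e e0) [N _ HN] := s0; exists N => // n /= Nn.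
apply: ereal_sup_ubound; exists (s n) => //; split => //; first by exists s => //; exists n.
by apply: le_lt_trans (ler_norm _) (HN _ Nn).
Qed.

(** The indices of a subsequence taken within [F] need not increase, so any
    term of a succession can be moved to the front, while the tail is thinned
    to have norms as small as desired. *)
Lemma row_through_division (e : nat -> R) (D : {fset (interval R)}) :
  (forall n, 0 < e n) ->
  G D -> division A B S X D -> div_norm D < e 0%N ->
  exists s, [/\ F s, riemann_succession A B S X s, s 0%N = D &
    forall n, div_norm (s n) < e n].
Proof.
move=> e0 [s Fs [n0 ->]] DX De.
have [sX s0] := succession_of_division hF Fs DX.
have [k [koo k0 ke]] := cvg0_subseq_lt s0 e0 De.
exists (fun n => s (k n)); split=> //; last by rewrite k0.
  exact (sf_subseq hF Fs koo).
by split=> [n|]; [exact: sX|exact: cvg_comp koo s0].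
Qed.

Hypotheses (hX : Sbar A B S X) (hdiag : diagonal_axiom A B S F).

(** The bound 1/(i+n+1) on the norm at (i, n) makes the whole array, and not
    only each row, small away from the origin; the diagonal succession is then
    Riemann because [i + n] tends to infinity along it. *)
Lemma upper_norm_limit_le_burkill :
  (upper_norm_limit A B S g G X <= upper_burkill A B S g F X)%E.
Proof.
apply: lee_of_fin_below => r rL.
have row i : exists s, [/\ F s, riemann_succession A B S X s,
    r < div_sum g (s 0%N) & forall n, div_norm (s n) < (i + n).+1%:R^-1].
  have /ereal_sup_gt[_ [D [GD DX De] <-]] :
      (r%:E < ereal_sup (sums_below A B S g G X i.+1%:R^-1))%E.
    apply: lt_le_trans rL _; apply: ereal_inf_lbound.
    by exists i.+1%:R^-1 => //=; rewrite invr_gt0.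
  rewrite lte_fin => rD.
  have [||s [Fs sX s0 se]] :=
    @row_through_division (fun n => (i + n).+1%:R^-1) D _ GD DX.
  - by move=> n; rewrite invr_gt0.
  - by rewrite addn0.
  by exists s; split=> //; rewrite s0.
have [s sP] := choice row.
pose E m := s (diag_index m).1 (diag_index m).2.
have EX : riemann_succession A B S X E.
  split=> [m|]; first by have [_ [+ _] _ _] := sP (diag_index m).1; apply.
  apply/cvgr0Pnorm_lt => e e0.
  have sum_small : \forall m \near \oo,
      ((diag_index m).1 + (diag_index m).2).+1%:R^-1 < e.
    exact: diag_index_sum_cvg _ (near_infty_natSinv_lt (PosNum e0)).
  near=> m; rewrite ger0_norm ?div_norm_ge0//.
  have [_ _ _ /(_ (diag_index m).2)/lt_trans] := sP (diag_index m).1; apply.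
  by near: m; exact: sum_small.
have FE : F E by apply: hdiag hX _ EX => i; have [] := sP i.
apply: le_ereal_sup_tmp; exists (limn_esup (fun n => (div_sum g (E n))%:E)).
  by exists E.
apply: le_limn_esup_frequently => i; have [m im mi] := diag_index_start i.
by exists m => //; rewrite lee_fin /E mi/= ltW//; have [] := sP i.
Unshelve. all: by end_near. Qed.

End norm_limit.

Lemma div_sumN (R : realType) (g : interval R -> R) (D : {fset (interval R)}) :
  div_sum (fun I => - g I) D = - div_sum g D.
Proof. exact: sumrN. Qed.

Lemma lower_burkillE (R : realType) (A B : R) (S : set (interval R))
    (g : interval R -> R) (F : set (nat -> {fset (interval R)})) (X : set R) :
  lower_burkill A B S g F X = (- upper_burkill A B S (fun I => - g I)%R F X)%E.
Proof.
rewrite /lower_burkill ereal_infEN; congr (- ereal_sup _)%E.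
rewrite image_comp; apply: eq_imagel => D _ /=; rewrite -limn_esupN.
by congr limn_esup; apply/funext => n /=; rewrite div_sumN.
Qed.

Lemma lower_norm_limitE (R : realType) (A B : R) (S : set (interval R))
    (g : interval R -> R) (G : set {fset (interval R)}) (X : set R) :
  lower_norm_limit A B S g G X =
  (- upper_norm_limit A B S (fun I => - g I)%R G X)%E.
Proof.
rewrite /lower_norm_limit ereal_supEN; congr (- ereal_inf _)%E.
rewrite image_comp; apply: eq_imagel => e _ /=; rewrite -ereal_supN.
congr ereal_sup; rewrite /sums_below image_comp.
by apply: eq_imagel => D _ /=; rewrite div_sumN.
Qed.

Theorem mainTheorem1 (R : realType) (A B : R) (hAB : A < B)
  (S : set (interval R)) (hS : S `<=` itvs A B) (hS0 : S !=set0)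
  (g : interval R -> R)
  (F : set (nat -> {fset (interval R)})) (hF : succession_family A B S F)
  (X : set R) (hX : Sbar A B S X) :
  let G := family_divisions F in
  [/\ (lower_norm_limit A B S g G X <= lower_burkill A B S g F X)%E,
      (lower_burkill A B S g F X <= upper_burkill A B S g F X)%E &
      (upper_burkill A B S g F X <= upper_norm_limit A B S g G X)%E] /\
  (diagonal_axiom A B S F ->
     lower_norm_limit A B S g G X = lower_burkill A B S g F X /\
     upper_norm_limit A B S g G X = upper_burkill A B S g F X).
Proof.
move=> G; split; [split|move=> hdiag; split].
- by rewrite lower_norm_limitE lower_burkillE leeN2 upper_burkill_le_norm_limit.
- have [D FD DX] := sf_exists hF hX.
  apply: (@le_trans _ _ (limn_einf (fun n => (div_sum g (D n))%:E))).
    by apply: ereal_inf_lbound; exists D.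
  apply: le_trans (limn_einf_sup _) _.
  by apply: ereal_sup_ubound; exists D.
- exact: upper_burkill_le_norm_limit.
- rewrite lower_norm_limitE lower_burkillE; congr (- _)%E; apply/eqP.
  by rewrite eq_le upper_norm_limit_le_burkill// upper_burkill_le_norm_limit.
- apply/eqP.
  by rewrite eq_le upper_norm_limit_le_burkill// upper_burkill_le_norm_limit.
Qed.
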